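(* Let $\tau>0$ and consider the transmission protocol with one-bit channel state feedback, threshold $\tau$, and on-off power allocation described in the context. Its wideband outage exponent is $$\mathcal{E}(\eta)=\begin{cases}\tau+(1-x^\ast)\left[\frac{1}{\eta}-\tau-1-\log\left(\frac{1}{\eta}-\tau\right)\right]-x^\ast\log(e^\tau-1)-H_\mathrm{b}(x^\ast) & \text{if } \frac{1}{\tau+1}\le\eta\le\frac{1}{\tau},\\[4pt] \tau-\log(e^\tau-1) & \text{if } \eta>\frac{1}{\tau},\end{cases}$$ where $$x^\ast=\frac{(e^\tau-1)\exp(1/\eta-\tau-1)}{(e^\tau-1)\exp(1/\eta-\tau-1)+1/\eta-\tau}$$ and $H_\mathrm{b}(x):=-x\log x-(1-x)\log(1-x)$ is the binary entropy function. At $\eta=1/\tau$ (where $x^\ast=1$) the first expression is read with the conventions $0\cdot\infty=0$ and $0\log 0=0$.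
   Context: Setting (one-bit feedback, on-off power allocation, over $K$ i.i.d. parallel scalar Rayleigh fading channels). Channel $k$ is $Y_k=H_kX_k+Z_k$ with $Z_k\sim\mathcal{CN}(0,1)$ and $|H_k|^2$ i.i.d. exponential with mean 1. The transmitter is told, for each $k$, whether $|H_k|^2>\tau$. Let $K_1$ be the number of channels with $|H_k|^2>\tau$, so $K_1\sim\mathrm{Binomial}(K,e^{-\tau})$. The total power $\rho>0$ is divided equally among these $K_1$ channels and the others receive no power (if $K_1=0$ no power is used). The total achievable rate (in nats) is the random variable $$R(K,\rho)=\sum_{j=1}^{K_1}\log\left(1+\frac{\rho}{K_1}A_j^{(1)}\right)$$ (equal to $0$ if $K_1=0$), where $A^{(1)}_1,A^{(1)}_2,\ldots$ are i.i.d. with density $e^{\tau-x}$ on $(\tau,\infty)$, independent of $K_1$. For an energy per nat $\eta>0$, with target rate $r=\rho/\eta$, the wideband outage exponent is $$\mathcal{E}(\eta):=\lim_{K\to\infty}\frac{-\log\Pr[R(K,\rho)\le r]}{K}.$$ All logarithms are natural. *)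

(* Defs.v *)
From HB Require Import structures.
From mathcomp Require Import all_boot all_order all_algebra finmap.
From mathcomp Require Import all_classical all_reals all_analysis.
Import Order.TTheory GRing.Theory Num.Theory.
Import numFieldNormedType.Exports.

Set Implicit Arguments.
Unset Strict Implicit.
Unset Printing Implicit Defensive.

Local Open Scope classical_set_scope.
Local Open Scope ring_scope.

Section independence.
Context {d : measure_display} {T : measurableType d} {R : realType}
  (P : probability T R).

Definition mutually_independent (X : nat -> T -> R) :=
  forall (J : {fset nat}) (B : nat -> set R),
    (forall j, measurable (B j)) ->
    P (\bigcap_(j in [set` J]) (X j @^-1` B j)) =
      (\prod_(j <- J) P (X j @^-1` B j))%E.

Definition sigma_of_sequence (X : nat -> T -> R) : set (set T) :=
  <<s [set E | exists j (B : set R), measurable B /\ E = X j @^-1` B] >>.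

(* [nat] carries its discrete sigma-algebra, so [B] ranges over all its
   subsets. *)
Definition independent_of_sequence (N : T -> nat) (X : nat -> T -> R) :=
  forall (B : set nat) (C : set T), sigma_of_sequence X C ->
    P ((N @^-1` B) `&` C) = (P (N @^-1` B) * P C)%E.

Definition has_density (X : T -> R) (f : R -> R) :=
  forall B : set R, measurable B ->
    P (X @^-1` B) = (\int[lebesgue_measure]_(x in B) (f x)%:E)%E.

End independence.

Section one_bit_feedback.
Context {T : Type} {R : realType}.
Implicit Types (G A : nat -> T -> R) (tau rho x : R).

Definition active_gain_pdf tau x : R :=
  if tau < x then expR (tau - x) else 0.

(* [G k] is the power gain |H_k|^2 of the k-th channel. *)
Definition num_active tau G (K : nat) (w : T) : nat :=
  (\sum_(k < K) (tau < G k w)%R)%N.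

Definition rate tau rho G A (K : nat) (w : T) : R :=
  let K1 := num_active tau G K w in
  \sum_(j < K1) ln (1 + rho / K1%:R * A j w).

End one_bit_feedback.

Definition normalized_outage_exponent {d : measure_display}
    {T : measurableType d} {R : realType} (P : probability T R)
    (tau rho eta : R) (G A : nat -> T -> R) (K : nat) : R :=
  - ln (fine (P [set w | rate tau rho G A K w <= rho / eta])) / K%:R.

(* [ln 0 = 0], which gives the convention 0 log 0 = 0. *)
Definition binary_entropy {R : realType} (x : R) : R :=
  - x * ln x - (1 - x) * ln (1 - x).

Definition xstar {R : realType} (tau eta : R) : R :=
  let c := (expR tau - 1) * expR (eta^-1 - tau - 1) in
  c / (c + eta^-1 - tau).

(* At eta = 1/tau, [xstar tau eta = 1] and [ln (eta^-1 - tau) = ln 0 = 0], so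
   the bracketed term contributes 0, as in the convention 0 * oo = 0. *)
Definition exponent_formula {R : realType} (tau eta : R) : R :=
  let x := xstar tau eta in
  tau + (1 - x) * (eta^-1 - tau - 1 - ln (eta^-1 - tau))
    - x * ln (expR tau - 1) - binary_entropy x.

(* Main.v *)
(* Write [p = e^(-tau)] and [a = 1/eta - tau].  Given [K1 = n], the rate is close
   to [rho] times the empirical mean of the [A_j], so by Cramer's theorem for
   exponential variables its outage probability is, up to subexponential
   factors, [b^n] with [b = a e^(1-a)] ([b = 0] if [a <= 0]).  Averaging [b^K1]
   over the binomial law of [K1] gives [(1 - p + p b)^K], and the exponent of the
   theorem is [- ln (1 - p + p b)] in closed form.
   Both halves of Cramer's theorem are obtained by cutting the range of the [A_j]
   into small intervals, which turns products of independent variables into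
   finite sums over [{ffun 'I_n -> I}]: the upper bound is Chernoff's, and the
   lower bound compares with the volume of a simplex. *)
Require Import Defs.
From HB Require Import structures.
From mathcomp Require Import all_boot all_order all_algebra finmap.
From mathcomp Require Import all_classical all_reals all_analysis.
From mathcomp Require Import measurable_realfun ring lra.
Import Order.TTheory GRing.Theory Num.Theory.
Import numFieldNormedType.Exports.

Set Implicit Arguments.
Unset Strict Implicit.
Unset Printing Implicit Defensive.

Local Open Scope classical_set_scope.
Local Open Scope ring_scope.

(** * Elementary bounds for the exponential, the logarithm and the Chernoff factor *)

Lemma expR1_le (R : realType) (m : nat) : (0 < m)%N ->
  expR 1 * (m%:R / m.+1%:R) ^+ m.+1 <= 1 :> R.
Proof.
move=> m0; have m1 : (0 : R) < m.+1%:R by rewrite ltr0n.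
have -> : m%:R / m.+1%:R = 1 - m.+1%:R^-1 :> R.
  by rewrite -[in LHS](addrK 1 m%:R) natr1 mulrBl mulfV ?gt_eqF // mul1r.
have h : 1 - m.+1%:R^-1 <= expR (- m.+1%:R^-1) :> R by exact: expR_ge1Dx.
have h0 : 0 <= 1 - m.+1%:R^-1 :> R by rewrite subr_ge0 invf_le1 // ler1n.
apply: (@le_trans _ _ (expR 1 * expR (- m.+1%:R^-1) ^+ m.+1)).
  by rewrite ler_pM2l ?expR_gt0 // lerXn2r ?nnegrE ?expR_ge0.
by rewrite -expRM_natl mulrN mulfV ?gt_eqF // expRN mulfV ?gt_eqF ?expR_gt0.
Qed.

(** A weak Stirling bound, [n! <= e (n + 1) (n / e)^n]. It turns the volume of a simplex into the
    [n]-th power of the Chernoff factor at the cost of a polynomial factor only. *)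
Lemma expR_le_exprn_fact (R : realType) (n : nat) :
  expR n%:R <= expR 1 * n.+1%:R * (n%:R ^+ n / n`!%:R) :> R.
Proof.
case: n => [|n].
  rewrite expR0 expr0 fact0 divr1 !mulr1.
  by rewrite (le_trans _ (expR_ge1Dx 1)) // lerDl.
(* For positive [n] the prefactor [e n] suffices, and this sharper form is what the induction
   carries: from [m] to [m + 1] the right-hand side grows by [((m + 1) / m)^(m + 1)], which is at
   least [e] by [expR1_le]. At [n = 0] the sharper form is false, whence the case split. *)
apply: (@le_trans _ _ (expR 1 * n.+1%:R * (n.+1%:R ^+ n.+1 / n.+1`!%:R))); last first.
  by rewrite ler_wpM2r ?divr_ge0 ?exprn_ge0 // ler_wpM2l ?expR_ge0 // ler_nat.
elim: n => [|n IHn]; first by rewrite expr1 divr1 !mulr1.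
have n1 : (0 : R) < n.+1%:R by rewrite ltr0n.
have n2 : (0 : R) < n.+2%:R by rewrite ltr0n.
have nf : (0 : R) < n.+1`!%:R by rewrite ltr0n fact_gt0.
have e2 : expR n.+2%:R = expR n.+1%:R * expR 1 :> R by rewrite -natr1 expRD.
rewrite e2.
have := expR1_le R (ltn0Sn n); rewrite expr_div_n.
set m := n.+1%:R in n1 IHn *; rewrite mulrA ler_pdivrMr ?exprn_gt0 // mul1r => h.
apply: (le_trans (ler_wpM2r (expR_ge0 1) IHn)).
rewrite (factS n.+1) natrM.
have -> : expR 1 * n.+2%:R * (n.+2%:R ^+ n.+2 / (n.+2%:R * n.+1`!%:R)) =
  expR 1 * (n.+2%:R ^+ n.+2 / n.+1`!%:R) :> R by field; lra.
have -> : expR 1 * m * (m ^+ n.+1 / n.+1`!%:R) * expR 1 =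
  expR 1 * ((expR 1 * m ^+ n.+2) / n.+1`!%:R).
  by rewrite (exprS m n.+1); field; lra.
by rewrite ler_pM2l ?expR_gt0 // ler_pM2r ?invr_gt0.
Qed.

(** Take [ln (1 + y) <= y] at [y = - x / (1 + x)]. For [x] of order [1 / n], as in the rate,
    linearising the logarithm this way loses only a factor [1 + O(1 / n)]. *)
Lemma ln1D_ge (R : realType) (x : R) : 0 <= x -> x / (1 + x) <= ln (1 + x).
Proof.
move=> x0; have x1 : 0 < 1 + x by lra.
have : ln (1 + (- (x / (1 + x)))) <= - (x / (1 + x)).
  apply: le_ln1Dx; rewrite ltrN2 ltr_pdivrMr //; lra.
have -> : 1 + - (x / (1 + x)) = (1 + x)^-1 by field; lra.
by rewrite lnV ?posrE // lerN2.
Qed.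

Lemma expRN_le_inv1D (R : realType) (y : R) : 0 <= y -> expR (- y) <= (1 + y)^-1.
Proof.
move=> y0; rewrite expRN lef_pV2 ?posrE ?expR_gt0 ?expR_ge1Dx //; lra.
Qed.

(* For [a <= 1], the infimum over [s >= 0] of the Chernoff factor
   [e^(s a) / (1 + s)] of a unit exponential variable: attained at [s = 1 / a - 1]
   if [0 < a], approached as [s] tends to infinity if [a <= 0]. *)
Definition chernoff_factor (R : realType) (a : R) : R :=
  if 0 <= a then a * expR (1 - a) else 0.

Lemma chernoff_factor_approx (R : realType) (a e : R) : a <= 1 -> 0 < e ->
  exists2 s, 0 <= s & expR (s * a) / (1 + s) <= chernoff_factor a + e.
Proof.
move=> a1 e0; case: (ltP 0 a) => a0.
  exists (a^-1 - 1); first by rewrite subr_ge0 invf_ge1.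
  rewrite /chernoff_factor (ltW a0) mulrBl mulVf ?gt_eqF // mul1r.
  have -> : 1 + (a^-1 - 1) = a^-1 by ring.
  by rewrite invrK mulrC lerDl ltW.
(* For [a <= 0] the numerator is at most 1, so it is enough that [1 / (1 + s) <= e]. *)
exists e^-1; first by rewrite invr_ge0 ltW.
have ei0 : 0 < e^-1 by rewrite invr_gt0.
have c0 : 0 <= chernoff_factor a.
  by rewrite /chernoff_factor; case: ifP => // a0'; rewrite mulr_ge0 ?expR_ge0.
apply: (@le_trans _ _ e); last by lra.
rewrite ler_pdivrMr; last by lra.
rewrite mulrDr mulr1 mulfV ?gt_eqF //.
apply: (@le_trans _ _ 1); last by lra.
by rewrite -expR0 ler_expR; nra.
Qed.

Lemma geometric_expR (R : realType) (x : R) (M : nat) :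
  (1 - expR (- x)) * \sum_(i < M) expR (- (i%:R * x)) = 1 - expR (- (M%:R * x)).
Proof.
rewrite mulr_sumr -(big_mkord xpredT (fun i => (1 - expR (- x)) * expR (- (i%:R * x)))).
rewrite (@telescope_sumr_eq _ 0 M (fun i => - expR (- (i%:R * x)))) //=.
  by rewrite mul0r oppr0 expR0 opprK addrC.
move=> i _; rewrite mulrBl mul1r -expRD.
have -> : - x + - (i%:R * x) = - (i.+1%:R * x) :> R by rewrite -natr1; ring.
by rewrite opprK addrC.
Qed.

(** * Probabilities of products of cells for independent variables *)

Section cells.
Context {d : measure_display} {T : measurableType d} {R : realType}
  (P : probability T R) (X : nat -> {RV P >-> R}).

Definition prb (E : set T) : R := fine (P E).

Lemma prbE (E : set T) : measurable E -> P E = (prb E)%:E.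
Proof. by move=> mE; rewrite fineK // fin_num_measure. Qed.

Lemma prb_ge0 (E : set T) : 0 <= prb E.
Proof. exact: fine_ge0. Qed.

Lemma prb_le (E F : set T) : measurable E -> measurable F -> E `<=` F -> prb E <= prb F.
Proof.
by move=> mE mF EF; rewrite -lee_fin -!prbE // le_measure ?inE.
Qed.

Lemma prb_bigsetU_le (J : Type) (s : seq J) (S : pred J) (D : J -> set T) :
  (forall c, measurable (D c)) ->
  prb (\big[setU/set0]_(c <- s | S c) D c) <= \sum_(c <- s | S c) prb (D c).
Proof.
move=> mD; elim: s => [|c s IHs]; first by rewrite !big_nil /prb measure0.
rewrite !big_cons; case: ifP => // _.
apply: le_trans (lerD (lexx _) IHs).
have mU : measurable (\big[setU/set0]_(j <- s | S j) D j).
  by apply: bigsetU_measurable.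
rewrite -lee_fin EFinD -!prbE //; last exact: measurableU.
by apply: measureU2.
Qed.

Lemma prb_bigsetU (J : choiceType) (s : seq J) (S : pred J) (D : J -> set T) :
  (forall c, measurable (D c)) -> uniq s -> trivIset setT D ->
  prb (\big[setU/set0]_(c <- s | S c) D c) = \sum_(c <- s | S c) prb (D c).
Proof.
move=> mD + tD; elim: s => [|c s IHs]; first by rewrite !big_nil /prb measure0.
move=> /=/andP[cs us]; rewrite !big_cons; case: ifP => _; rewrite -IHs //.
have mU : measurable (\big[setU/set0]_(j <- s | S j) D j).
  by apply: bigsetU_measurable.
apply: EFin_inj; rewrite EFinD -!prbE //; last exact: measurableU.
apply: measureU => //.
rewrite -bigcup_seq_cond; apply/seteqP; split => // w [/= cw [k /= /andP[ks _] kw]].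
have ck : c = k by apply: (tD c k) => //; exists w.
by rewrite ck ks in cs.
Qed.

Definition cells_event (I : finType) (B : I -> set R) (n : nat)
    (c : {ffun 'I_n -> I}) : set T :=
  [set w | forall j : 'I_n, B (c j) (X j w)].

Definition cell_prb (B : set R) (j : nat) : R := prb (X j @^-1` B).

Context (I : finType) (B : I -> set R).
Hypothesis mB : forall i, measurable (B i).

Lemma measurable_preimage_RV (j : nat) (C : set R) : measurable C ->
  measurable (X j @^-1` C).
Proof. by move=> mC; rewrite -[_ @^-1` _]setTI; apply: measurable_funP. Qed.

Lemma measurable_cells_event (n : nat) (c : {ffun 'I_n -> I}) :
  measurable (cells_event B c).
Proof.
have -> : cells_event B c = \bigcap_(j in [set: 'I_n]) (X j @^-1` B (c j)).
  by apply/seteqP; split=> w /= h j; [move=> _|]; apply: h.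
apply: fin_bigcap_measurable => // j _; exact: measurable_preimage_RV.
Qed.

Hypothesis indX : mutually_independent P X.

Lemma prb_cells_event (n : nat) (c : {ffun 'I_n -> I}) :
  prb (cells_event B c) = \prod_(j < n) cell_prb (B (c j)) j.
Proof.
(* Mutual independence speaks of families indexed by all of [nat], so the cells are extended by
   [setT] from index [n] on; [J] is [{0, ..., n - 1}] as a finite set. *)
pose C (j : nat) : set R :=
  if insub j is Some k then B (c k) else setT.
have mC j : measurable (C j) by rewrite /C; case: insubP.
have CE (j : 'I_n) : C j = B (c j) by rewrite /C valK.
have [J JE Jp] : exists2 J : {fset nat}, forall j, (j \in J) = (j < n)%N &
    perm_eq J (iota 0 n).
  exists (seq_fset tt (iota 0 n)) => [j|]; first by rewrite seq_fsetE mem_iota.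
  by rewrite (perm_trans (seq_fset_perm _ _)) // undup_id ?iota_uniq.
have -> : cells_event B c = \bigcap_(j in [set` J]) (X j @^-1` C j).
  apply/seteqP; split=> w /= h => [j /=|j].
    by rewrite JE => jn; have := h (Ordinal jn); rewrite -CE.
  by rewrite -CE; apply: h => /=; rewrite JE.
have e : (\prod_(j <- J) P (X j @^-1` C j) =
   \prod_(0 <= j < n) P (X j @^-1` C j))%E.
  by rewrite /index_iota subn0; apply: perm_big.
rewrite /prb indX // e big_mkord.
rewrite (eq_bigr (fun j : 'I_n => (cell_prb (B (c j)) j)%:E)).
  by rewrite prodEFin.
by move=> j _; rewrite CE prbE //; apply: measurable_preimage_RV.
Qed.

Lemma cells_event_trivIset (n : nat) : trivIset setT B ->
  trivIset setT (@cells_event I B n).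
Proof.
move=> tB c1 c2 _ _ [w [/= h1 h2]]; apply/ffunP => j.
by apply: (tB (c1 j) (c2 j)) => //; exists (X j w).
Qed.

(** Discretisation from above: the boxes of [S] cover [E], the union bound applies, and independence
    factors each box. *)
Lemma prb_le_cells (n : nat) (S : pred {ffun 'I_n -> I}) (E : set T) :
  measurable E ->
  (forall w, E w -> exists2 c, S c & cells_event B c w) ->
  prb E <= \sum_(c | S c) \prod_(j < n) cell_prb (B (c j)) j.
Proof.
move=> mE ES.
have mD (c : {ffun 'I_n -> I}) : measurable (cells_event B c) by exact: measurable_cells_event.
under eq_bigr do rewrite -prb_cells_event.
apply: le_trans (prb_bigsetU_le _ _ mD); apply: prb_le => //.
  by apply: bigsetU_measurable.
move=> w /ES[c Sc h]; rewrite -bigcup_seq_cond; exists c => //=.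
by rewrite mem_index_enum.
Qed.

(** Discretisation from below: the boxes of [S] lie in [E] and are disjoint, so their probabilities
    add up. *)
Lemma prb_ge_cells (n : nat) (S : pred {ffun 'I_n -> I}) (E : set T) :
  measurable E -> trivIset setT B ->
  (forall c, S c -> cells_event B c `<=` E) ->
  \sum_(c | S c) \prod_(j < n) cell_prb (B (c j)) j <= prb E.
Proof.
move=> mE tB ES.
have mD (c : {ffun 'I_n -> I}) : measurable (cells_event B c) by exact: measurable_cells_event.
under eq_bigr do rewrite -prb_cells_event.
rewrite -prb_bigsetU ?index_enum_uniq //; last exact: cells_event_trivIset.
apply: prb_le => //; first by apply: bigsetU_measurable.
by move=> w; rewrite -bigcup_seq_cond => -[c /= /andP[_ Sc]]; apply: ES.
Qed.

End cells.

(** * Tails and interval probabilities of the gains *)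

Lemma integral_expRB_itvoy (R : realType) (a b : R) :
  (\int[lebesgue_measure]_(x in `]b, +oo[) (expR (a - x))%:E =
   (expR (a - b))%:E)%E.
Proof.
have cE : continuous (fun x : R => expR (a - x)).
  move=> x; apply: continuous_comp; last exact: continuous_expR.
  by apply: cvgB; [exact: cvg_cst | exact: cvg_id].
have cNE : continuous (fun x : R => - expR (a - x)).
  by move=> x; apply: cvgN; apply: cE.
have dNE (x : R) : is_derive x 1 (fun x : R => - expR (a - x)) (expR (a - x)).
  by apply: is_derive_eq; rewrite add0r mul1r mulrN1 opprK.
rewrite integral_itv_obnd_cbnd; last first.
  by apply/measurable_EFinP; apply: measurable_funTS; exact: continuous_measurable_fun.
rewrite (@ge0_continuous_FTC2y _ _ (fun x => - expR (a - x)) _ 0) //.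
- by rewrite EFinN oppeK add0e.
- by apply: continuous_subspaceT.
- rewrite -oppr0; apply: cvgN.
  rewrite -(mulr0 (expR a)); under eq_cvg do rewrite expRD.
  by apply: cvgMr; exact: cvgr_expR.
- by apply/cvg_at_right_filter; exact: cNE.
- by move=> x _; rewrite derive1E derive_val.
Qed.

(** The density is constrained beyond [b] only, so that one statement serves both the channel gains
    ([a = 0]) and the active gains ([a = tau]). *)
Lemma exponential_tail_prb {d : measure_display} {T : measurableType d}
    {R : realType} (P : probability T R) (X : {RV P >-> R}) (f : R -> R)
    (a b : R) :
  has_density P X f -> (forall x, b < x -> f x = expR (a - x)) ->
  prb P (X @^-1` `]b, +oo[) = expR (a - b).
Proof.
move=> Xf fE; rewrite /prb Xf //.
transitivity (fine (\int[lebesgue_measure]_(x in `]b, +oo[) (expR (a - x))%:E)%E).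
  congr fine; apply: eq_integral => x.
  by rewrite inE /= in_itv /= andbT => bx; rewrite fE.
by rewrite integral_expRB_itvoy.
Qed.

Section gain_laws.
Context {d : measure_display} {T : measurableType d} {R : realType}
  (P : probability T R) (tau : R) (A : nat -> {RV P >-> R}).
Hypothesis Alaw : forall j, has_density P (A j) (active_gain_pdf tau).

Lemma active_gain_tail (b : R) (j : nat) : 0 <= b ->
  cell_prb A `]tau + b, +oo[ j = expR (- b).
Proof.
move=> b0; rewrite /cell_prb (exponential_tail_prb (a := tau) (Alaw j)).
  by congr expR; ring.
by move=> x bx; rewrite /active_gain_pdf ifT // (le_lt_trans _ bx) // lerDl.
Qed.

Lemma active_gain_itv (b c : R) (j : nat) : 0 <= b -> b <= c ->
  cell_prb A `]tau + b, tau + c] j = expR (- b) - expR (- c).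
Proof.
move=> b0 bc.
rewrite -(active_gain_tail j b0) -(active_gain_tail j (le_trans b0 bc)).
apply/eqP; rewrite eq_sym subr_eq; apply/eqP.
have m1 : measurable (A j @^-1` `]tau + b, tau + c]) by exact: measurable_preimage_RV.
have m2 : measurable (A j @^-1` `]tau + c, +oo[) by exact: measurable_preimage_RV.
apply: EFin_inj; rewrite EFinD /cell_prb -!prbE //; last first.
  exact: measurable_preimage_RV.
rewrite -measureU //.
  rewrite -preimage_setU; congr (P (_ @^-1` _)).
  rewrite -itv_bndbnd_setU // bnd_simp ?lerD2l //.
rewrite -preimage_setI; apply/seteqP; split => // w /= [].
rewrite !in_itv /= => /andP[_ h1] /andP[h2 _]; by move: (lt_le_trans h2 h1); rewrite ltxx.
Qed.

Lemma active_gain_le_tau (j : nat) : cell_prb A `]-oo, tau] j = 0.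
Proof.
have := active_gain_tail j (lexx 0); rewrite oppr0 expR0 addr0 /cell_prb => h.
have -> : A j @^-1` `]-oo, tau] = ~` (A j @^-1` `]tau, +oo[).
  by rewrite preimage_setC setCitvr.
have m2 : measurable (A j @^-1` `]tau, +oo[) by exact: measurable_preimage_RV.
apply: EFin_inj; rewrite -prbE; last exact: measurableC.
by rewrite probability_setC // prbE // h subee.
Qed.

End gain_laws.

(** * Outage conditioned on the number of active channels *)

Definition rate_event {d : measure_display} {T : measurableType d} {R : realType}
    (A : nat -> T -> R) (rho r : R) (n : nat) : set T :=
  [set w | \sum_(j < n) ln (1 + rho / n%:R * A j w) <= r].

Lemma measurable_rate_event {d : measure_display} {T : measurableType d}
    {R : realType} (A : nat -> T -> R) (rho r : R) (n : nat) :
  (forall j, measurable_fun setT (A j)) -> measurable (rate_event A rho r n).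
Proof.
move=> mA.
have mf : measurable_fun setT (fun w => \sum_(j < n) ln (1 + rho / n%:R * A j w)).
  apply: measurable_sum => j; apply: measurableT_comp; first exact: measurable_ln.
  apply: measurable_funD; first exact: measurable_cst.
  by apply: measurable_funM; first exact: measurable_cst.
have -> : rate_event A rho r n =
    (fun w => \sum_(j < n) ln (1 + rho / n%:R * A j w)) @^-1` `]-oo, r].
  by apply/seteqP; split => w; rewrite /rate_event /= in_itv.
by rewrite -[_ @^-1` _]setTI; apply: mf.
Qed.

(** With the number of active channels frozen at [n], the event involves the [A j] alone. The
    previous lemma is reused on [T] equipped with the sigma-algebra that they generate. *)
Lemma sigma_of_sequence_rate_event {d : measure_display} {T : measurableType d}
    {R : realType} (A : nat -> T -> R) (rho r : R) (n : nat) :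
  sigma_of_sequence A (rate_event A rho r n).
Proof.
pose Gen := [set E | exists j (B : set R), measurable B /\ E = A j @^-1` B].
apply: (@measurable_rate_event _ (g_sigma_algebraType Gen) R A rho r n).
move=> j _ B mB; rewrite setTI; apply: sub_sigma_algebra.
by exists j, B.
Qed.

Section active_channels.
Context {d : measure_display} {T : measurableType d} {R : realType}
  (P : probability T R) (tau rho r : R) (G A : nat -> {RV P >-> R}).
Hypothesis tau0 : 0 <= tau.
Hypothesis Glaw : forall k, has_density P (G k) (exponential_pdf 1).
Hypothesis Gind : mutually_independent P G.
Hypothesis AK1 : forall K, independent_of_sequence P (num_active tau G K) A.

Let B (b : bool) : set R := if b then `]tau, +oo[%classic else `]-oo, tau]%classic.

Let p (b : bool) : R := if b then expR (- tau) else 1 - expR (- tau).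

Let mB b : measurable (B b).
Proof. by rewrite /B; case: b; apply: measurable_itv. Qed.

Let tB : trivIset setT B.
Proof.
move=> b1 b2 _ _ [x []]; case: b1; case: b2 => //=; rewrite !in_itv /= ?andbT.
  by move=> h1 h2; move: (lt_le_trans h1 h2); rewrite ltxx.
by move=> h2 h1; move: (lt_le_trans h1 h2); rewrite ltxx.
Qed.

Let pB b k : cell_prb G (B b) k = p b.
Proof.
have h : cell_prb G `]tau, +oo[ k = expR (- tau).
  rewrite /cell_prb (exponential_tail_prb (a := 0) (Glaw k)) ?sub0r // => x taux.
  rewrite exponential_pdfE; first by rewrite mul1r mulN1r sub0r.
  by rewrite (le_trans tau0) // ltW.
case: b => //=; rewrite -h /cell_prb.
have -> : G k @^-1` `]-oo, tau] = ~` (G k @^-1` `]tau, +oo[).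
  by rewrite preimage_setC setCitvr.
have m2 : measurable (G k @^-1` `]tau, +oo[) by exact: measurable_preimage_RV.
apply: EFin_inj; rewrite -prbE; last exact: measurableC.
by rewrite probability_setC // prbE // EFinB.
Qed.

Let active (K : nat) (w : T) : {ffun 'I_K -> bool} := [ffun k : 'I_K => tau < G k w].

Let active_cells (K : nat) (c : {ffun 'I_K -> bool}) (w : T) :
  cells_event G B c w <-> c = active K w.
Proof.
split => [h|->].
  apply/ffunP => k; rewrite ffunE; have := h k.
  case: (c k); rewrite /B /= in_itv /= ?andbT; first by move=> ->.
  by rewrite leNgt => /negbTE ->.
move=> k /=; rewrite ffunE /B; by case: ltP => /= h; rewrite in_itv /= ?andbT.
Qed.

Let num_activeE (K : nat) (w : T) :
  num_active tau G K w = (\sum_(k < K) active K w k)%N.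
Proof. by apply: eq_bigr => k _; rewrite ffunE. Qed.

Let num_active_cells (K n : nat) : num_active tau G K @^-1` [set n] =
  \big[setU/set0]_(c : {ffun 'I_K -> bool} | (\sum_k c k == n)%N) cells_event G B c.
Proof.
rewrite -bigcup_seq_cond; apply/seteqP; split => w /=.
  move=> h; exists (active K w); last exact/active_cells.
  by rewrite /= mem_index_enum -num_activeE h eqxx.
by move=> [c /= /andP[_ /eqP <-]] /active_cells ->; rewrite num_activeE.
Qed.

Let measurable_num_active (K n : nat) : measurable (num_active tau G K @^-1` [set n]).
Proof.
rewrite num_active_cells; apply: bigsetU_measurable => c _.
exact: measurable_cells_event.
Qed.

(** Total probability over [K1], with each value of [K1] split further into activation patterns [c].
    Summing over patterns avoids binomial coefficients and makes the next lemma a mere distribution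
    of a product over a sum. *)
Lemma outage_prb (K : nat) :
  prb P [set w | rate tau rho G A K w <= r] =
  \sum_(c : {ffun 'I_K -> bool}) (\prod_k p (c k)) *
    prb P (rate_event A rho r (\sum_k c k)).
Proof.
have mA j : measurable_fun setT (A j) by exact: measurable_funP.
have mE n := measurable_rate_event rho r n mA.
have NK (c : {ffun 'I_K -> bool}) : (\sum_k c k < K.+1)%N.
  rewrite ltnS -[leqRHS]card_ord -sum1_card; apply: leq_sum => k _; exact: leq_b1.
have -> : [set w | rate tau rho G A K w <= r] =
    \big[setU/set0]_(0 <= n < K.+1)
      (num_active tau G K @^-1` [set n] `&` rate_event A rho r n).
  rewrite -bigcup_seq_cond; apply/seteqP; split => w /=.
    move=> h; exists (num_active tau G K w) => //=.
    by rewrite mem_index_iota num_activeE NK.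
  by move=> [n _ [/= <-]].
rewrite prb_bigsetU ?iota_uniq //; last 2 first.
- by move=> n; apply: measurableI.
- by move=> n m _ _ [w [[/= <- _] [<- _]]].
rewrite big_mkord.
(* Patterns are grouped by their number of active channels; [NK] makes [inord] faithful. *)
rewrite (partition_big (fun c : {ffun 'I_K -> bool} => inord (\sum_k c k) : 'I_K.+1) xpredT) //=.
apply: eq_bigr => n _.
have -> : prb P (num_active tau G K @^-1` [set (n : nat)] `&` rate_event A rho r n) =
    prb P (num_active tau G K @^-1` [set (n : nat)]) * prb P (rate_event A rho r n).
  apply: EFin_inj; rewrite EFinM -!prbE //; last exact: measurableI.
  apply: AK1; exact: sigma_of_sequence_rate_event.
rewrite num_active_cells prb_bigsetU ?index_enum_uniq //; last 2 first.
- by move=> c; exact: measurable_cells_event.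
- exact: cells_event_trivIset.
rewrite mulr_suml; apply: eq_big => [c|c /eqP <-].
  by rewrite -val_eqE /= inordK.
rewrite prb_cells_event //; congr (_ * _).
by apply: eq_bigr => k _; rewrite pB.
Qed.

(** The generating function of the binomial law: every channel contributes [1 - p] if inactive and
    [p x] if active. *)
Lemma sum_active_prod (K : nat) (x : R) :
  \sum_(c : {ffun 'I_K -> bool}) (\prod_k p (c k)) * x ^+ (\sum_k c k) =
  (1 - expR (- tau) + expR (- tau) * x) ^+ K.
Proof.
transitivity (\sum_(c : {ffun 'I_K -> bool}) \prod_k (p (c k) * x ^+ c k)).
  by apply: eq_bigr => c _; rewrite big_split /= -expr_sum.
rewrite -(bigA_distr_bigA (fun (_ : 'I_K) (b : bool) => p b * x ^+ b)) /=.
by rewrite prodr_const card_ord big_bool /= expr0 expr1 mulr1 addrC.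
Qed.

Lemma outage_prb_le (C x : R) : (forall n, prb P (rate_event A rho r n) <= C * x ^+ n) ->
  forall K, prb P [set w | rate tau rho G A K w <= r] <=
    C * (1 - expR (- tau) + expR (- tau) * x) ^+ K.
Proof.
move=> h K; rewrite outage_prb -sum_active_prod mulr_sumr; apply: ler_sum => c _.
rewrite mulrCA ler_wpM2l //; apply: prodr_ge0 => k _.
rewrite -(pB _ 0); exact: prb_ge0.
Qed.

(** The hypothesis is restricted to [n <= K] so that [C] may depend on [K], as the polynomial loss
    [1 / (K + 1)] does. *)
Lemma outage_prb_ge (C x : R) (K : nat) :
  (forall n, (n <= K)%N -> C * x ^+ n <= prb P (rate_event A rho r n)) ->
  C * (1 - expR (- tau) + expR (- tau) * x) ^+ K <=
    prb P [set w | rate tau rho G A K w <= r].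
Proof.
move=> h; rewrite outage_prb -sum_active_prod mulr_sumr; apply: ler_sum => c _.
rewrite mulrCA ler_wpM2l //.
  by apply: prodr_ge0 => k _; rewrite -(pB _ 0); exact: prb_ge0.
apply: h; rewrite -[leqRHS]card_ord -sum1_card; apply: leq_sum => k _; exact: leq_b1.
Qed.

End active_channels.

(** * Chernoff upper bound for a fixed number of active channels *)

Section rate_upper.
Context {d : measure_display} {T : measurableType d} {R : realType}
  (P : probability T R) (tau rho u : R) (A : nat -> {RV P >-> R}).
Hypothesis tau0 : 0 <= tau.
Hypothesis rho0 : 0 < rho.
Hypothesis u0 : 0 <= u.
Hypothesis Alaw : forall j, has_density P (A j) (active_gain_pdf tau).
Hypothesis Aind : mutually_independent P A.

(* The null cell [i = 0] below [tau], then [M] cells of width [delta], then a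
   tail; [gain_cell_inf] bounds each of the non-null cells from below. *)
Definition gain_cell (delta : R) (M i : nat) : set R :=
  match i with
  | 0 => `]-oo, tau]%classic
  | k.+1 => if (k < M)%N then `]tau + k%:R * delta, tau + k.+1%:R * delta]%classic
            else `]tau + k%:R * delta, +oo[%classic
  end.

Definition gain_cell_inf (delta : R) (i : nat) : R := tau + i.-1%:R * delta.

Lemma measurable_gain_cell delta M i : measurable (gain_cell delta M i).
Proof.
case: i => [|k] /=; first exact: measurable_itv.
by case: ifP => _; exact: measurable_itv.
Qed.

(** By induction on [M]: going to [M + 1] splits the tail beyond [tau + M delta] into one more
    interval and a new tail. *)
Lemma gain_cell_cover (delta : R) (M : nat) (x : R) : 0 < delta ->
  exists i : 'I_M.+2, gain_cell delta M i x.
Proof.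
move=> delta0; case: (leP x tau) => taux.
  by exists ord0; rewrite /= in_itv.
elim: M => [|M [[i /= iM] ix]].
  exists (Ordinal (ltnSn 1)) => /=.
  by rewrite mul0r addr0 in_itv /= taux.
case: i iM ix => [|i] /= iM.
  by rewrite in_itv /= leNgt taux.
case: ltnP => [iM' ix|Mi].
  exists (Ordinal (leqW iM)) => /=; by rewrite ifT // ltnW.
have -> : i = M by apply/eqP; rewrite eqn_leq Mi -ltnS -ltnS iM.
rewrite /= in_itv /= andbT => Mx.
case: (leP x (tau + M.+1%:R * delta)) => xM.
  exists (Ordinal (leqW (ltnSn M.+1))) => /=; by rewrite ltnSn /= in_itv /= Mx.
by exists (Ordinal (ltnSn M.+2)) => /=; rewrite ltnn /= in_itv /= xM.
Qed.

Lemma gain_cell_inf_le (delta : R) (M i : nat) (x : R) :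
  (0 < i)%N -> gain_cell delta M i x -> gain_cell_inf delta i <= x.
Proof.
case: i => // k _ /=; rewrite /gain_cell_inf /=.
by case: ifP => _; rewrite /= in_itv /= => /andP[/ltW].
Qed.

(** A Riemann-sum version of the Laplace transform of [A j] at [s], whose exact value is
    [e^(- s tau) / (1 + s)]. *)
Lemma sum_gain_cell (delta s : R) (M j : nat) : 0 <= delta ->
  \sum_(i < M.+2) cell_prb A (gain_cell delta M i) j *
      expR (- (s * gain_cell_inf delta i)) =
  expR (- (s * tau)) * ((1 - expR (- delta)) *
      \sum_(k < M) expR (- (k%:R * ((1 + s) * delta)))
    + expR (- (M%:R * ((1 + s) * delta)))).
Proof.
move=> delta0.
rewrite big_ord_recl /= active_gain_le_tau // mul0r add0r.
rewrite big_ord_recr /= /gain_cell_inf /= ltnn active_gain_tail ?mulr_ge0 //.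
rewrite [RHS]mulrDr; congr (_ + _); last by rewrite -!expRD; congr expR; ring.
rewrite !mulr_sumr; apply: eq_bigr => k _ /=.
rewrite /= !add0n ltn_ord active_gain_itv ?mulr_ge0 //; last first.
  by rewrite ler_wpM2r // ler_nat.
have -> : expR (- (k.+1%:R * delta)) = expR (- (k%:R * delta)) * expR (- delta).
  by rewrite -expRD -natr1; congr expR; ring.
have -> : expR (- (s * (tau + k%:R * delta))) =
  expR (- (s * tau)) * expR (- (k%:R * (s * delta))).
  by rewrite -expRD; congr expR; ring.
have -> : expR (- (k%:R * ((1 + s) * delta))) =
  expR (- (k%:R * delta)) * expR (- (k%:R * (s * delta))).
  by rewrite -expRD; congr expR; ring.
ring.
Qed.

(** With [y = (1 + s) delta], the geometric sum is at most [1 / (1 - e^(- y))], hence at most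
    [(1 + y) / y]; times [delta] this is [1 / (1 + s) + delta]. So [delta] is the error of the mesh
    and [1 / (1 + M delta)] that of the truncation. *)
Lemma sum_gain_cell_le (delta s : R) (M j : nat) : 0 < delta -> 0 <= s ->
  \sum_(i < M.+2) cell_prb A (gain_cell delta M i) j *
      expR (- (s * gain_cell_inf delta i)) <=
  expR (- (s * tau)) * ((1 + s)^-1 + delta + (1 + M%:R * delta)^-1).
Proof.
move=> delta0 s0; rewrite (sum_gain_cell _ _ _ (ltW delta0)) ler_pM2l ?expR_gt0 //.
set y := (1 + s) * delta; have y0 : 0 < y by rewrite mulr_gt0 //; lra.
have s1 : 0 < 1 + s by lra.
apply: lerD; last first.
  apply: le_trans (expRN_le_inv1D _) _; first by rewrite mulr_ge0 // ltW.
  have Md : 0 <= M%:R * delta by rewrite mulr_ge0 // ltW.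
  have Ms : 0 <= s * (M%:R * delta) by rewrite mulr_ge0.
  rewrite lef_pV2 ?posrE; rewrite /y; nra.
have := geometric_expR y M; set S := \sum_(i < M) _ => hS.
have e1 : y / (1 + y) <= 1 - expR (- y).
  have := expRN_le_inv1D (ltW y0).
  have -> : y / (1 + y) = 1 - (1 + y)^-1 by field; lra.
  by rewrite lerD2l lerN2.
have e2 : 1 - expR (- delta) <= delta.
  by have := expR_ge1Dx (- delta); lra.
have S0 : 0 <= S by apply: sumr_ge0 => k _; exact: expR_ge0.
have S1 : y / (1 + y) * S <= 1.
  apply: (le_trans (ler_wpM2r S0 e1)); rewrite hS.
  by have := expR_ge0 (- (M%:R * y)); lra.
apply: (le_trans (ler_wpM2r S0 e2)).
have -> : delta * S = ((1 + s)^-1 + delta) * (y / (1 + y) * S).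
  rewrite /y; field; apply/andP; split; last by lra.
  by rewrite -/y; lra.
rewrite -[leRHS]mulr1 ler_wpM2l //.
by rewrite addr_ge0 ?invr_ge0 ?(ltW s1) ?(ltW delta0).
Qed.

(** Rounding the gains down to at most [V = tau + M delta] and using [ln1D_ge], outage forces the
    rounded gains to sum to at most [n u + D] with [D = rho u V]. As [D] does not depend on [n], the
    logarithm costs only the prefactor [e^(s D)]. *)
Lemma rate_event_prb_le_cells (delta s : R) (M n : nat) : 0 < delta -> 0 <= s ->
  prb P (rate_event A rho (rho * u) n) <=
  expR (s * (rho * u * (tau + M%:R * delta))) *
  (expR (s * (u - tau)) * ((1 + s)^-1 + delta + (1 + M%:R * delta)^-1)) ^+ n.
Proof.
move=> delta0 s0; set D := rho * u * (tau + M%:R * delta).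
pose B (i : 'I_M.+2) := gain_cell delta M i.
have mB i : measurable (B i) by exact: measurable_gain_cell.
pose v (i : 'I_M.+2) := gain_cell_inf delta i.
have v0 i : 0 <= v i by rewrite /v /gain_cell_inf addr_ge0 // mulr_ge0 // ltW.
have vM i : v i <= tau + M%:R * delta.
  rewrite /v /gain_cell_inf lerD2l ler_wpM2r ?(ltW delta0) // ler_nat.
  by case: (nat_of_ord i) (ltn_ord i).
pose S (c : {ffun 'I_n -> 'I_M.+2}) :=
  [exists j, c j == ord0] || (\sum_j v (c j) <= n%:R * u + D).
have D0 : 0 <= D.
  by rewrite !mulr_ge0 ?(ltW rho0) // addr_ge0 // mulr_ge0 // ltW.
have ES w : rate_event A rho (rho * u) n w -> exists2 c, S c & cells_event A B c w.
  move=> Ew.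
  have [c cB] : exists c : {ffun 'I_n -> 'I_M.+2}, cells_event A B c w.
    have h (j : 'I_n) := gain_cell_cover M (A j w) delta0.
    exists [ffun j => sval (cid (h j))] => j; rewrite ffunE /B.
    by case: (cid (h j)).
  exists c => //; rewrite /S; case: existsP => //= c0.
  have cv (j : 'I_n) : v (c j) <= A j w.
    apply: gain_cell_inf_le (cB j); rewrite lt0n; apply/eqP => cj.
    by apply: c0; exists j; apply/eqP/val_inj.
  (* The case [n = 0] is apart because [rho / n] is inverted below. *)
  case: n @S c Ew cB c0 cv => [|n] S c Ew cB c0 cv.
    by rewrite big_ord0 mul0r add0r.
  have n0 : (0 : R) < n.+1%:R by rewrite ltr0n.
  have V0 : 0 <= tau + M%:R * delta by apply: le_trans (v0 ord0) (vM _).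
  set y := rho / n.+1%:R.
  have y0 : 0 < y by rewrite divr_gt0.
  have y1 : 0 < 1 + y * (tau + M%:R * delta) by rewrite ltr_wpDr // mulr_ge0 // ltW.
  have h : y * (\sum_j v (c j)) / (1 + y * (tau + M%:R * delta)) <= rho * u.
    apply: le_trans Ew; rewrite mulr_sumr mulr_suml; apply: ler_sum => j _.
    have yv : 0 <= y * v (c j) by rewrite mulr_ge0 // ltW.
    have yA : 0 <= y * (A j w - v (c j)) by rewrite mulr_ge0 ?subr_ge0 ?(ltW y0) ?cv.
    rewrite mulrBr subr_ge0 in yA.
    apply: (@le_trans _ _ (ln (1 + y * v (c j)))); last first.
      by rewrite ler_ln ?posrE ?lerD2l // ltr_pwDl // (le_trans yv).
    apply: le_trans (ln1D_ge yv); rewrite ler_wpM2l //.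
    rewrite lef_pV2 ?posrE ?ltr_pwDl //.
    - by rewrite lerD2l ler_pM2l.
    - by rewrite mulr_ge0 // ltW.
  rewrite ler_pdivrMr // in h.
  have -> : n.+1%:R * u + D =
      y^-1 * (rho * u * (1 + y * (tau + M%:R * delta))).
    rewrite /y /D; set N : R := n.+1%:R in n0 *.
    by field; rewrite nat1r pnatr_eq0 /= lt0r_neq0.
  by rewrite mulrC ler_pdivlMr // mulrC.
have mA j : measurable_fun setT (A j) by exact: measurable_funP.
apply: le_trans (prb_le_cells mB Aind (measurable_rate_event _ _ _ mA) ES) _.
(* Chernoff's weight [exp (s (n u + D - sum_j v (c j)))] is at least 1 on the relevant vectors and
   nonnegative elsewhere, so the sum may run over all [c] and then factors over [j]. *)
apply: (@le_trans _ _ (\sum_(c : {ffun 'I_n -> 'I_M.+2})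
   (\prod_j (cell_prb A (B (c j)) j * expR (- (s * v (c j))))) *
   expR (s * (n%:R * u + D)))).
  rewrite big_mkcond; apply: ler_sum => c _.
  have p0 : 0 <= \prod_(j < n) (cell_prb A (B (c j)) j * expR (- (s * v (c j)))).
    by apply: prodr_ge0 => j _; apply: mulr_ge0; [exact: prb_ge0|exact: expR_ge0].
  case: ifP => [/orP[/existsP[j /eqP cj]|cS]|_]; last by rewrite mulr_ge0 ?expR_ge0.
    rewrite (bigD1 j) //= cj /B /= active_gain_le_tau // mul0r.
    by rewrite mulr_ge0 ?expR_ge0.
  rewrite big_split /= -mulrA ler_peMr //.
    by apply: prodr_ge0 => j _; exact: prb_ge0.
  rewrite -expR_sum -expRD; apply: le_trans (expR_ge1Dx _).
  by rewrite lerDl sumrN -mulr_sumr addrC subr_ge0; apply: ler_wpM2l.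
rewrite -mulr_suml -(bigA_distr_bigA (fun (j : 'I_n) i =>
  cell_prb A (B i) j * expR (- (s * v i)))) /=.
apply: (@le_trans _ _ ((\prod_(j < n) (expR (- (s * tau)) *
  ((1 + s)^-1 + delta + (1 + M%:R * delta)^-1))) * expR (s * (n%:R * u + D)))).
  rewrite ler_pM2r ?expR_gt0 //; apply: ler_prod => j _.
  rewrite sum_gain_cell_le // andbT; apply: sumr_ge0 => i _.
  by rewrite mulr_ge0 ?expR_ge0 ?prb_ge0.
have -> : s * (n%:R * u + D) = s * D + n%:R * (s * (u - tau)) + n%:R * (s * tau).
  by ring.
rewrite prodr_const card_ord exprMn !expRD expRN !expRM_natl.
rewrite [in leRHS]exprMn le_eqVlt; apply/orP; left; apply/eqP.
by rewrite exprVn; field; rewrite expf_neq0 // gt_eqF ?expR_gt0.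
Qed.

Lemma rate_event_prb_le (e : R) : u - tau <= 1 -> 0 < e ->
  exists2 C, 0 < C & forall n, prb P (rate_event A rho (rho * u) n) <=
    C * (chernoff_factor (u - tau) + e) ^+ n.
Proof.
move=> ut e0.
have [s s0 hs] := chernoff_factor_approx ut (divr_gt0 e0 (ltr0Sn R 1)).
set E := expR (s * (u - tau)) in hs; have E0 : 0 < E := expR_gt0 _.
(* The error [e] is spent as [e / 2] on the choice of [s], [e / 4] on the mesh and [e / 4] on the
   truncation; [M >= delta^-2] makes the truncation error at most [delta]. *)
pose delta := e / (4 * E).
have delta0 : 0 < delta by rewrite divr_gt0 // mulr_gt0.
pose M := Num.bound (delta^-1 / delta).
have Md : (1 + M%:R * delta)^-1 <= delta.
  have Md0 : 0 < 1 + M%:R * delta by rewrite ltr_pwDl // mulr_ge0 // ltW.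
  rewrite invf_ple ?posrE //.
  have : delta^-1 / delta <= M%:R.
    by apply/ltW/archi_boundP; rewrite divr_ge0 ?invr_ge0 ?(ltW delta0).
  by rewrite ler_pdivrMr //; lra.
exists (expR (s * (rho * u * (tau + M%:R * delta)))); first exact: expR_gt0.
move=> n; apply: le_trans (rate_event_prb_le_cells M n delta0 s0) _.
rewrite ler_pM2l ?expR_gt0 // lerXn2r ?nnegrE //.
- have : 0 <= (1 + s)^-1 by rewrite invr_ge0; lra.
  have : 0 <= (1 + M%:R * delta)^-1.
    by rewrite invr_ge0 addr_ge0 // mulr_ge0 // ltW.
  by move=> h1 h2; rewrite mulr_ge0 ?(ltW E0) // !addr_ge0 // ltW.
- apply: addr_ge0; last exact: ltW.
  by rewrite /chernoff_factor; case: ifP => // h; rewrite mulr_ge0 ?expR_ge0.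
- rewrite -/E.
  have : E * delta = e / 4 by rewrite /delta; field; lra.
  have := ler_wpM2l (ltW E0) Md.
  by rewrite !mulrDr; lra.
Qed.

End rate_upper.

(** * Lower bound by counting grid cubes inside a simplex *)

(** Stars and bars, carried over from tuples to finite functions. *)
Lemma card_ffun_sum_le (n m : nat) :
  #|[pred c : {ffun 'I_n -> 'I_m.+1} | (\sum_j c j <= m)%N]| = 'C(n + m, n).
Proof.
rewrite -card_partial_ord_partitions.
pose f (t : n.-tuple 'I_m.+1) : {ffun 'I_n -> 'I_m.+1} := [ffun j => tnth t j].
have fI : injective f.
  move=> t1 t2 /ffunP h; apply: eq_from_tnth => j.
  by have := h j; rewrite !ffunE.
rewrite -(card_imset _ fI); apply: eq_card => c; rewrite !inE.
apply/idP/imsetP => [h|[t]].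
  exists [tuple c j | j < n]; last by apply/ffunP => j; rewrite ffunE tnth_mktuple.
  rewrite inE big_tuple; under eq_bigr do rewrite tnth_mktuple.
  exact: h.
rewrite inE big_tuple => h ->.
by under eq_bigr do rewrite ffunE.
Qed.

(** The right-hand side is a falling factorial whose [n] factors are all at least [k]. *)
Lemma exprn_le_bin (n k : nat) : (k ^ n <= 'C(n + k, n) * n`!)%N.
Proof.
rewrite bin_ffact ffact_prod -[in leqLHS](card_ord n) -prod_nat_const.
by apply: leq_prod => i _; rewrite addnC -addnBA ?leq_addr // ltnW.
Qed.

Lemma bernoulli_ge (R : realType) (x : R) (n : nat) : 0 <= x <= 1 ->
  1 - n%:R * x <= (1 - x) ^+ n.
Proof.
move=> /andP[x0 x1]; elim: n => [|n IHn]; first by rewrite mul0r subr0 expr0.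
rewrite exprS; have x1' : 0 <= 1 - x by lra.
apply: le_trans (ler_wpM2l x1' IHn); rewrite -natr1.
have : 0 <= (n%:R : R) * x * x by rewrite !mulr_ge0.
by nra.
Qed.

Lemma rate_event0 {d : measure_display} {T : measurableType d} {R : realType}
    (A : nat -> T -> R) (rho r : R) : 0 <= r -> rate_event A rho r 0 = setT.
Proof.
by move=> r0; apply/seteqP; split => // w _; rewrite /rate_event /= big_ord0.
Qed.

Section rate_lower.
Context {d : measure_display} {T : measurableType d} {R : realType}
  (P : probability T R) (tau rho u : R) (A : nat -> {RV P >-> R}).
Hypothesis tau0 : 0 <= tau.
Hypothesis rho0 : 0 < rho.
Hypothesis tauu : tau <= u.
Hypothesis Alaw : forall j, has_density P (A j) (active_gain_pdf tau).
Hypothesis Aind : mutually_independent P A.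

(** Since [ln (1 + x) <= x], outage holds once [sum_j A_j <= n u]. Cubes of side [delta] with index
    sum at most [m] satisfy this: their upper corners add one step per coordinate, whence [n + m].
    Each such cube has probability at least [(1 - e^(- delta))^n e^(- n (u - tau))]. *)
Lemma rate_event_prb_ge_cells (delta : R) (n m : nat) : 0 < delta ->
  (n + m)%:R * delta <= n%:R * (u - tau) ->
  (1 - expR (- delta)) ^+ n * expR (- (n%:R * (u - tau))) * 'C(n + m, n)%:R <=
  prb P (rate_event A rho (rho * u) n).
Proof.
move=> delta0 hdelta.
pose B (i : 'I_m.+1) : set R := `]tau + i%:R * delta, tau + i.+1%:R * delta]%classic.
have mB i : measurable (B i) by exact: measurable_itv.
have tB : trivIset setT B.
  move=> i k _ _ [x []]; rewrite /B /= !in_itv /= => /andP[i1 i2] /andP[k1 k2].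
  have aux (a b : nat) : tau + a%:R * delta < x -> x <= tau + b.+1%:R * delta ->
      (a <= b)%N.
    move=> h1 h2; have := lt_le_trans h1 h2.
    by rewrite ltrD2l ltr_pM2r // ltr_nat ltnS.
  by apply/val_inj/eqP; rewrite eqn_leq !aux.
pose S (c : {ffun 'I_n -> 'I_m.+1}) := (\sum_j c j <= m)%N.
have mA j : measurable_fun setT (A j) by exact: measurable_funP.
have ES c : S c -> cells_event A B c `<=` rate_event A rho (rho * u) n.
  move=> cS w cB.
  have cA (j : 'I_n) : tau + (c j)%:R * delta < A j w /\ A j w <= tau + (c j).+1%:R * delta.
    by have := cB j; rewrite /B /= in_itv /= => /andP.
  rewrite /rate_event /=.
  case: n @S hdelta c cS cB cA => [|n] S hd c cS cB cA.
    by rewrite big_ord0 mulr_ge0 ?(ltW rho0) // (le_trans tau0).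
  set y := rho / n.+1%:R.
  have y0 : 0 < y by rewrite divr_gt0.
  apply: (@le_trans _ _ (y * \sum_(j < n.+1) (tau + (c j).+1%:R * delta))).
    rewrite mulr_sumr; apply: ler_sum => j _; have [h1 h2] := cA j.
    have A0 : 0 <= A j w.
      by rewrite (le_trans _ (ltW h1)) // addr_ge0 // mulr_ge0 // ltW.
    have yA : 0 <= y * A j w by rewrite mulr_ge0 // ltW.
    apply: (@le_trans _ _ (y * A j w)); last by rewrite ler_pM2l.
    by apply: le_ln1Dx; lra.
  have -> : \sum_(j < n.+1) (tau + (c j).+1%:R * delta) =
      n.+1%:R * tau + (n.+1 + \sum_j c j)%:R * delta.
    rewrite big_split /= sumr_const card_ord -mulr_suml mulr_natl.
    congr (_ + _ * _); rewrite -natr_sum; congr _%:R.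
    under eq_bigr do rewrite -addn1.
    by rewrite big_split /= sum_nat_const card_ord muln1 addnC.
  have h3 : (n.+1 + \sum_j c j)%:R * delta <= n.+1%:R * (u - tau).
    by apply: le_trans hd; rewrite ler_pM2r // ler_nat leq_add2l.
  have -> : rho * u = y * (n.+1%:R * u).
    by rewrite /y; field; rewrite nat1r pnatr_eq0.
  by rewrite ler_pM2l //; lra.
apply: le_trans (prb_ge_cells mB Aind (measurable_rate_event _ _ _ mA) tB ES).
rewrite -card_ffun_sum_le -mulr_natr -sum1_card natr_sum mulr_sumr.
apply: ler_sum => c cS; rewrite mulr1.
have pB (j : 'I_n) : cell_prb A (B (c j)) j =
    (1 - expR (- delta)) * expR (- ((c j)%:R * delta)).
  rewrite /B active_gain_itv ?mulr_ge0 ?(ltW delta0) //; last first.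
    by rewrite ler_pM2r // ler_nat.
  by rewrite mulrBl mul1r -expRD -natr1; congr (_ - expR _); ring.
under [leRHS]eq_bigr do rewrite pB.
have q0 : 0 <= 1 - expR (- delta) by rewrite subr_ge0 -expR0 ler_expR oppr_le0 ltW.
rewrite big_split /= prodr_const card_ord ler_wpM2l ?exprn_ge0 //.
rewrite -expR_sum ler_expR sumrN lerN2 -mulr_suml -natr_sum.
rewrite mul1r; apply: le_trans hdelta; rewrite ler_pM2r // ler_nat.
by apply: (leq_trans cS); exact: leq_addl.
Qed.

(* The right-hand event contains [sum_j (A_j - tau) <= n (u - tau)], and the
   density of the [A_j - tau] is at least [e^(- n (u - tau))] on that simplex,
   whose volume is [(n (u - tau))^n / n!]. *)
Lemma rate_event_prb_ge (n : nat) : tau < u -> (0 < n)%N ->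
  expR (- (n%:R * (u - tau))) * (n%:R * (u - tau)) ^+ n / n`!%:R <=
  prb P (rate_event A rho (rho * u) n).
Proof.
move=> tu n0; set x := n%:R * (u - tau).
have nR : (0 : R) < n%:R by rewrite ltr0n.
have x0 : 0 < x by rewrite mulr_gt0 // subr_gt0.
have f0 : (0 : R) < n`!%:R by rewrite ltr0n fact_gt0.
set F := prb _ _.
(* The mesh [x / (n + k)] fills the simplex up to a relative error that vanishes as [k] grows:
   [1 - e^(- delta) >= delta / (1 + delta)] and [exprn_le_bin] leave the factor
   [(k / (k + n + x))^n], to which Bernoulli's inequality applies. *)
have bound (k : nat) :
    expR (- x) * x ^+ n / n`!%:R * (1 - n%:R * ((n%:R + x) / (k%:R + (n%:R + x)))) <= F.
  have k0 : (0 : R) <= k%:R by [].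
  pose delta := x / (n + k)%:R.
  have nk : (0 : R) < (n + k)%:R by rewrite ltr0n ltn_addr.
  have delta0 : 0 < delta by rewrite divr_gt0.
  have hd : (n + k)%:R * delta <= x by rewrite mulrC divfK ?gt_eqF.
  apply: le_trans (rate_event_prb_ge_cells (m := k) delta0 hd); rewrite -/x.
  have e1 : x / (k%:R + (n%:R + x)) <= 1 - expR (- delta).
    have := expRN_le_inv1D (ltW delta0).
    have -> : x / (k%:R + (n%:R + x)) = 1 - (1 + delta)^-1.
      rewrite /delta natrD in nk *; field; do ?[apply/andP; split]; lra.
    by rewrite lerD2l lerN2.
  have z0 : 0 <= x / (k%:R + (n%:R + x)) by rewrite divr_ge0 //; lra.
  have e2 : (x / (k%:R + (n%:R + x))) ^+ n <= (1 - expR (- delta)) ^+ n.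
    by rewrite lerXn2r ?nnegrE // (le_trans z0).
  have e3 : k%:R ^+ n / n`!%:R <= 'C(n + k, n)%:R :> R.
    by rewrite ler_pdivrMr // -natrX -natrM ler_nat exprn_le_bin.
  have e4 : 1 - n%:R * ((n%:R + x) / (k%:R + (n%:R + x))) <=
      (k%:R / (k%:R + (n%:R + x))) ^+ n.
    have -> : k%:R / (k%:R + (n%:R + x)) = 1 - (n%:R + x) / (k%:R + (n%:R + x)).
      by field; lra.
    apply: bernoulli_ge; rewrite divr_ge0 ?ler_pdivrMr; lra.
  apply: (@le_trans _ _ ((x / (k%:R + (n%:R + x))) ^+ n * expR (- x) * (k%:R ^+ n / n`!%:R))).
    have -> : (x / (k%:R + (n%:R + x))) ^+ n * expR (- x) * (k%:R ^+ n / n`!%:R) =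
        expR (- x) * x ^+ n / n`!%:R * (k%:R / (k%:R + (n%:R + x))) ^+ n.
      by rewrite !expr_div_n; ring.
    by rewrite ler_wpM2l // !mulr_ge0 ?expR_ge0 ?exprn_ge0 ?invr_ge0 ?(ltW x0) ?(ltW f0).
  apply: ler_pM => //.
  - by rewrite mulr_ge0 ?expR_ge0 ?exprn_ge0.
  - by rewrite ler_pM2r ?expR_gt0.
set V := expR (- x) * x ^+ n / n`!%:R in bound *.
have V0 : 0 < V by rewrite !mulr_gt0 ?expR_gt0 ?exprn_gt0 ?invr_gt0.
apply/ler_addgt0Pr => e e0.
pose z := n%:R + x; have z0 : 0 < z by rewrite addr_gt0.
(* This [k] brings the error [V n z / (k + z)] below [e]. *)
pose k := Num.bound (V * n%:R * z / e).
have hk : V * n%:R * z / e <= k%:R.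
  by apply/ltW/archi_boundP; rewrite divr_ge0 ?(ltW e0) // mulr_ge0 ?(ltW z0) // mulr_ge0 ?(ltW V0).
have := bound k; rewrite -/z => hF.
have kz : 0 < k%:R + z by rewrite ltr_wpDl.
have : V * (n%:R * (z / (k%:R + z))) <= e.
  rewrite !mulrA ler_pdivrMr // [leRHS]mulrDr; rewrite ler_pdivrMr // in hk.
  by rewrite (le_trans hk) // mulrC lerDl ltW // mulr_gt0.
by rewrite mulrBr mulr1 in hF; lra.
Qed.

(** The weak Stirling bound applied to [n^n / n!] in [rate_event_prb_ge]. If [u = tau] the Chernoff
    factor is 0, and only [n = 0], where outage is certain, has content. *)
Lemma rate_event_prb_ge_chernoff (n : nat) :
  expR (- 1) / n.+1%:R * chernoff_factor (u - tau) ^+ n <=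
  prb P (rate_event A rho (rho * u) n).
Proof.
have n1 : (0 : R) < n.+1%:R by rewrite ltr0n.
case: n n1 => [|n] n1.
  rewrite rate_event0 ?mulr_ge0 ?(ltW rho0) ?(le_trans tau0) //.
  rewrite /prb probability_setT.
  by rewrite expr0 mulr1 divr1 -expR0 ler_expR oppr_le0.
rewrite /chernoff_factor subr_ge0 tauu.
move: (tauu); rewrite le_eqVlt => /predU1P[<-|tu].
  by rewrite subrr mul0r expr0n mulr0 prb_ge0.
apply: le_trans (rate_event_prb_ge tu (ltn0Sn n)).
set m := n.+1 in n1 *; set a := u - tau.
have a0 : 0 < a by rewrite subr_gt0.
have f0 : (0 : R) < m`!%:R by rewrite ltr0n fact_gt0.
have h := expR_le_exprn_fact R m.
rewrite !exprMn -expRM_natl mulrBr mulr1 [expR (_ - _)]expRD.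
have -> : expR (- (m%:R * a)) * (m%:R ^+ m * a ^+ m) / m`!%:R =
  expR (- (m%:R * a)) * a ^+ m * (m%:R ^+ m / m`!%:R) by ring.
have -> : expR (-1) / m.+1%:R * (a ^+ m * (expR m%:R * expR (- (m%:R * a)))) =
  expR (- (m%:R * a)) * a ^+ m * (expR (-1) / m.+1%:R * expR m%:R) by ring.
rewrite ler_pM2l ?mulr_gt0 ?expR_gt0 ?exprn_gt0 //.
rewrite expRN -invfM ler_pdivrMl // mulr_gt0 ?expR_gt0 //.
Qed.

End rate_lower.

(** * From geometric bounds to the limit of the exponent *)

Lemma cvg_div_nat (R : realType) (c : R) : c / n%:R @[n --> \oo] --> (0 : R).
Proof.
rewrite -(mulr0 c); apply: cvgMr.
by rewrite -(cvg_shiftS (fun n => n%:R^-1 : R)); exact: cvg_harmonic.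
Qed.

(** With [m = min (1, e)], [m (n + 1) <= 1 + e n <= exp (e n)]; it remains to take logarithms. This
    bounds the cost of the polynomial prefactor. *)
Lemma ln_natS_le (R : realType) (e : R) (n : nat) : 0 < e ->
  ln n.+1%:R <= e * n%:R - ln (Num.min 1 e).
Proof.
move=> e0; set m := Num.min 1 e.
have m0 : 0 < m by rewrite lt_min ltr01.
have [m1 me] : m <= 1 /\ m <= e by rewrite !ge_min !lexx orbT.
have n0 : (0 : R) <= n%:R by [].
have n1 : (0 : R) < n.+1%:R by rewrite ltr0n.
have h : m * n.+1%:R <= expR (e * n%:R).
  apply: le_trans (expR_ge1Dx _); rewrite -natr1 mulrDr mulr1 addrC lerD //.
  by rewrite ler_wpM2r.
rewrite -ler_ln ?posrE ?expR_gt0 ?mulr_gt0 // lnM ?posrE // expRK in h.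
by lra.
Qed.

Lemma cvg_exponent (R : realType) (S : R) (pr : nat -> R) : 0 < S ->
  (forall e, 0 < e -> exists2 C, 0 < C & forall K, pr K <= C * (S + e) ^+ K) ->
  (forall K, expR (- 1) / K.+1%:R * S ^+ K <= pr K) ->
  - ln (pr K) / K%:R @[K --> \oo] --> - ln S.
Proof.
move=> S0 hU hL.
have pr0 K : 0 < pr K.
  by apply: lt_le_trans (hL K); rewrite mulr_gt0 ?exprn_gt0 ?divr_gt0 ?expR_gt0.
have lower K : (0 < K)%N -> - ln (pr K) / K%:R <= - ln S + (1 + ln K.+1%:R) / K%:R.
  move=> K0; have KR : (0 : R) < K%:R by rewrite ltr0n.
  have K1 : (0 : R) < K.+1%:R by rewrite ltr0n.
  have := hL K; rewrite -ler_ln ?posrE ?mulr_gt0 ?exprn_gt0 ?invr_gt0 ?expR_gt0 //.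
  rewrite lnM ?posrE ?exprn_gt0 ?divr_gt0 ?expR_gt0 // lnXn //.
  rewrite lnM ?posrE ?invr_gt0 ?expR_gt0 // lnV ?posrE // expRK -[ln S *+ K]mulr_natl => h.
  rewrite -[- ln S](mulfK (lt0r_neq0 KR)) // -mulrDl ler_pM2r ?invr_gt0 //; lra.
apply/cvgrPdist_le => e e0.
(* Chosen so that [S + e1 = S e^(e / 2)], which shifts the logarithm by exactly [e / 2]. *)
pose e1 := S * (expR (e / 2) - 1).
have e10 : 0 < e1 by rewrite mulr_gt0 // subr_gt0 expR_gt1; lra.
have [C C0 hC] := hU e1 e10.
have upper K : (0 < K)%N -> - ln S - e / 2 - ln C / K%:R <= - ln (pr K) / K%:R.
  move=> K0; have KR : (0 : R) < K%:R by rewrite ltr0n.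
  have Se : 0 < S + e1 by rewrite addr_gt0.
  have := hC K; rewrite -ler_ln ?posrE ?mulr_gt0 ?exprn_gt0 //.
  rewrite lnM ?posrE ?exprn_gt0 // lnXn //.
  have -> : S + e1 = S * expR (e / 2) by rewrite /e1; ring.
  rewrite lnM ?posrE ?expR_gt0 // expRK -[(ln S + e / 2) *+ K]mulr_natl => h.
  rewrite -[- ln S - e / 2](mulfK (lt0r_neq0 KR)) // -mulrBl ler_pM2r ?invr_gt0 //; lra.
have e2 : 0 < e / 2 by lra.
pose m := Num.min 1 (e / 2).
have cL := cvg_div_nat (1 - ln m).
have cU := cvg_div_nat (ln C).
near=> K.
have K0 : (0 < K)%N by near: K; exact: nbhs_infty_gt.
have KR : (0 : R) < K%:R by rewrite ltr0n.
have l0 : (1 + ln K.+1%:R) / K%:R <= e / 2 + (1 - ln m) / K%:R.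
  rewrite ler_pdivrMr // mulrDl divfK ?lt0r_neq0 //.
  by have := ln_natS_le K e2; rewrite -/m; lra.
have l1 : `|0 - (1 - ln m) / K%:R| <= e / 2.
  by near: K; move/cvgrPdist_le : cL; apply.
have l2 : `|0 - ln C / K%:R| <= e / 2.
  by near: K; move/cvgrPdist_le : cU; apply.
move: l1 l2 (lower K K0) (upper K K0); rewrite !ler_norml.
move=> /andP[h1 h2] /andP[h3 h4] h5 h6; apply/andP; split; lra.
Unshelve. all: by end_near.
Qed.

(** * Closed form of the exponent *)

(** Here [xstar] equals [(1 - p) / (1 - p + p b)], the share of inactive channels under the tilted
    law; substituting it into the entropy expression collapses everything to one logarithm. *)
Lemma exponent_formulaE (R : realType) (tau eta : R) : 0 < tau ->
  0 <= eta^-1 - tau ->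
  exponent_formula tau eta = - ln (1 - expR (- tau) +
    expR (- tau) * chernoff_factor (eta^-1 - tau)).
Proof.
move=> tau0; rewrite /chernoff_factor => a0; rewrite a0.
set a := eta^-1 - tau in a0 *; set E := expR (a - 1).
have EE : expR (1 - a) = E^-1 by rewrite -expRN; congr expR; ring.
have E0 : 0 < E := expR_gt0 _.
set t := expR tau; have t1 : 1 < t by rewrite expR_gt1.
have tt : expR (- tau) = t^-1 by rewrite expRN.
have lt : ln t = tau by rewrite expRK.
have lE : ln E = a - 1 by rewrite expRK.
have q0 : 0 < t - 1 by lra.
have c0 : 0 < (t - 1) * E by rewrite mulr_gt0.
have S0 : 0 < (t - 1) * E + a by lra.
have -> : 1 - expR (- tau) + expR (- tau) * (a * expR (1 - a)) =
    ((t - 1) * E + a) / (t * E).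
  rewrite EE tt; field; do ?[apply/andP; split]; lra.
have t0 : 0 < t by lra.
rewrite lnM ?posrE ?invr_gt0 ?mulr_gt0 // lnV ?posrE ?mulr_gt0 // lnM ?posrE //.
rewrite lt lE /exponent_formula /binary_entropy.
have -> : xstar tau eta = (t - 1) * E / ((t - 1) * E + a).
  by rewrite /xstar /= -[_ + eta^-1 - tau]addrA.
rewrite /= -/a -/t; set x := (t - 1) * E / _.
have lx : ln x = ln (t - 1) + (a - 1) - ln ((t - 1) * E + a).
  by rewrite /x lnM ?posrE ?invr_gt0 // lnV ?posrE // lnM ?posrE // lE.
have x1 : 1 - x = a / ((t - 1) * E + a) by rewrite /x; field; lra.
case: (ltgtP a 0) a0 => // [a0 _|a0 _].
  have lx1 : ln (1 - x) = ln a - ln ((t - 1) * E + a).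
    by rewrite x1 lnM ?posrE ?invr_gt0 // lnV ?posrE.
  rewrite lx lx1; ring.
(* At [a = 0] both [ln a] and [ln (1 - x)] are multiplied by [1 - x = 0]. *)
have e1 : 1 - x = 0 by rewrite x1 a0 mul0r.
rewrite e1 !mul0r lx; have -> : x = 1 by lra.
by rewrite a0; ring.
Qed.

Lemma no_gain_exponentE (R : realType) (tau : R) : 0 < tau ->
  tau - ln (expR tau - 1) = - ln (1 - expR (- tau)).
Proof.
move=> tau0; have t1 : 1 < expR tau by rewrite expR_gt1.
have -> : 1 - expR (- tau) = (expR tau - 1) / expR tau.
  by rewrite expRN; field; lra.
rewrite lnM ?posrE ?invr_gt0 ?expR_gt0 ?subr_gt0 // lnV ?posrE ?expR_gt0 //.
by rewrite expRK; ring.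
Qed.

(** * The two regimes of the exponent *)

Theorem proposition4 (R : realType) (d : measure_display)
    (T : measurableType d) (P : probability T R)
    (tau rho eta : R) (G A : nat -> {RV P >-> R})
    (htau : 0 < tau) (hrho : 0 < rho) (heta : 0 < eta)
    (hGlaw : forall k, has_density P (G k) (exponential_pdf 1))
    (hGind : mutually_independent P G)
    (hAlaw : forall j, has_density P (A j) (active_gain_pdf tau))
    (hAind : mutually_independent P A)
    (hAK1 : forall K, independent_of_sequence P (num_active tau G K) A) :
  ((tau + 1)^-1 <= eta <= tau^-1 ->
     normalized_outage_exponent P tau rho eta G A K @[K --> \oo]
       --> exponent_formula tau eta) /\
  (tau^-1 < eta ->
     normalized_outage_exponent P tau rho eta G A K @[K --> \oo]
       --> tau - ln (expR tau - 1)).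
Proof.
set a := eta^-1 - tau.
have p1 : expR (- tau) < 1 by rewrite -[ltRHS]expR0 ltr_expR oppr_lt0.
have p0 := expR_gt0 (- tau).
have eta0 : 0 <= eta^-1 by rewrite invr_ge0 ltW.
pose S := 1 - expR (- tau) + expR (- tau) * chernoff_factor a.
have b0 : 0 <= chernoff_factor a.
  by rewrite /chernoff_factor; case: ifP => // a0; rewrite mulr_ge0 ?expR_ge0.
have S0 : 0 < S by rewrite ltr_pwDl ?subr_gt0 // mulr_ge0 // ltW.
(* The upper bound on outage covers both regimes; they differ only in how the lower bound for fixed
   [n] is obtained. *)
have main : a <= 1 ->
    (forall n, expR (- 1) / n.+1%:R * chernoff_factor a ^+ n <=
       prb P (rate_event A rho (rho / eta) n)) ->
    normalized_outage_exponent P tau rho eta G A K @[K --> \oo] --> - ln S.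
  move=> a1 lower; apply: cvg_exponent => // [e e0|K].
    have [C C0 hC] := rate_event_prb_le (ltW htau) hrho eta0 hAlaw hAind a1 e0.
    exists C => // K.
    apply: le_trans (outage_prb_le (ltW htau) hGlaw hGind hAK1 hC K) _.
    rewrite ler_pM2l // lerXn2r ?nnegrE //.
    - by rewrite addr_ge0 ?subr_ge0 ?(ltW p1) // mulr_ge0 ?(ltW p0) // addr_ge0 // ltW.
    - by rewrite addr_ge0 // ltW.
    - by rewrite mulrDr addrA lerD2l ler_piMl ?(ltW e0) ?(ltW p1).
  apply: outage_prb_ge => // [|n nK]; first exact: ltW.
  apply: le_trans (lower n); rewrite ler_wpM2r ?exprn_ge0 //.
  by rewrite ler_pM2l ?expR_gt0 // lef_pV2 ?posrE // ler_nat.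
split => [/andP[h1 h2]|h].
- have a0 : 0 <= a by rewrite subr_ge0 -[tau]invrK lef_pV2 ?posrE ?invr_gt0.
  have a1 : a <= 1.
    by rewrite lerBlDl -[tau + 1]invrK lef_pV2 ?posrE ?invr_gt0 // addr_gt0.
  rewrite exponent_formulaE //; apply: main => // n.
  by apply: rate_event_prb_ge_chernoff => //; [exact: ltW | rewrite -subr_ge0].
- have a0 : a < 0 by rewrite subr_lt0 -[tau]invrK ltf_pV2 ?posrE ?invr_gt0.
  have b00 : chernoff_factor a = 0 by rewrite /chernoff_factor leNgt a0.
  (* For [a < 0] the Chernoff factor vanishes and [S = 1 - p]: what governs the exponent is that no
     channel is active, so the lower bound matters at [n = 0] only. *)
  rewrite no_gain_exponentE // -[1 - _]addr0 -(mulr0 (expR (- tau))) -b00.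
  apply: main => [|n]; first by rewrite (le_trans (ltW a0)).
  rewrite b00; case: n => [|n]; last by rewrite expr0n mulr0 prb_ge0.
  rewrite rate_event0 ?mulr_ge0 ?(ltW hrho) // /prb probability_setT.
  by rewrite expr0 mulr1 divr1 -expR0 ler_expR oppr_le0.
Qed.
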